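(* Let $(\boldsymbol{X}_k)_{k\in\mathbb{Z}_+}$ be a $p$-type Galton--Watson branching process with immigration, with generic offspring vectors $\boldsymbol{\xi}^{(1)},\dots,\boldsymbol{\xi}^{(p)}$ and generic immigration vector $\boldsymbol{\varepsilon}$. Assume that all entries of $\mathbb{E}(\boldsymbol{\xi}^{(i)})$, $i\in\{1,\dots,p\}$, are finite, that $\mathbb{E}(\boldsymbol{\varepsilon})\in\mathbb{R}_+^p\setminus\{\boldsymbol{0}\}$ (in particular finite), that $\varrho(\boldsymbol{M}_{\boldsymbol{\xi}})<1$, and that $\boldsymbol{M}_{\boldsymbol{\xi}}$ is primitive. Then for each $\alpha\in\{1,2,3\}$, the unique stationary distribution $\pi$ of $(\boldsymbol{X}_k)_{k\in\mathbb{Z}_+}$ has a finite $\alpha^{\mathrm{th}}$ moment, provided that the $\alpha^{\mathrm{th}}$ moments of $\boldsymbol{\xi}^{(i)}$, $i\in\{1,\dots,p\}$, and $\boldsymbol{\varepsilon}$ are finite.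
   Context: $\mathbb{Z}_+=\{0,1,2,\dots\}$, $\mathbb{N}=\{1,2,\dots\}$, $\mathbb{R}_+=[0,\infty)$, $p\in\mathbb{N}$. A $p$-type Galton--Watson branching process with immigration $(\boldsymbol{X}_k=[X_{k,1},\dots,X_{k,p}]^\top)_{k\in\mathbb{Z}_+}$ is given by $$\boldsymbol{X}_k=\sum_{i=1}^p\sum_{\ell=1}^{X_{k-1,i}}\boldsymbol{\xi}^{(i)}_{k,\ell}+\boldsymbol{\varepsilon}_k,\qquad k\in\mathbb{N}$$ (empty sums are $\boldsymbol{0}$), where $\{\boldsymbol{X}_0,\boldsymbol{\xi}^{(i)}_{k,\ell},\boldsymbol{\varepsilon}_k: k,\ell\in\mathbb{N}, i\in\{1,\dots,p\}\}$ are independent $\mathbb{Z}_+^p$-valued random vectors (the components of a vector need not be independent), for each $i$ the vectors $\boldsymbol{\xi}^{(i)}_{k,\ell}$, $k,\ell\in\mathbb{N}$, have the same distribution as a generic vector $\boldsymbol{\xi}^{(i)}$, and the $\boldsymbol{\varepsilon}_k$, $k\in\mathbb{N}$, have the same distribution as a generic vector $\boldsymbol{\varepsilon}$. $\boldsymbol{M}_{\boldsymbol{\xi}}:=\mathbb{E}([\boldsymbol{\xi}^{(1)},\dots,\boldsymbol{\xi}^{(p)}])\in\mathbb{R}_+^{p\times p}$ is the matrix whose $i$-th column is $\mathbb{E}(\boldsymbol{\xi}^{(i)})$, and $\varrho(\boldsymbol{M}_{\boldsymbol{\xi}})$ is its spectral radius. $\boldsymbol{M}_{\boldsymbol{\xi}}$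 is primitive if there is $n\in\mathbb{N}$ such that all entries of $\boldsymbol{M}_{\boldsymbol{\xi}}^n$ are positive. Under the assumptions of the claim, the Markov chain $(\boldsymbol{X}_k)_{k\in\mathbb{Z}_+}$ has a unique stationary distribution $\pi$ (a theorem of Quine, 1970). For $\alpha\in\mathbb{N}$, the $\alpha^{\mathrm{th}}$ moment of a random vector (or of its distribution) is said to be finite if all of its mixed moments of order $\alpha$ are finite. *)

(* Defs.v *)
From HB Require Import structures.
From mathcomp Require Import all_boot all_order all_algebra.
From mathcomp Require Import all_classical all_reals all_analysis.
From mathcomp Require Import complex.

Set Implicit Arguments.
Unset Strict Implicit.
Unset Printing Implicit Defensive.
Import Order.TTheory GRing.Theory Num.Theory.
Import numFieldNormedType.Exports.

Local Open Scope classical_set_scope.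
Local Open Scope ring_scope.

(* Vectors of Z_+^p are p-tuples of naturals; both [nat] and [p.-tuple nat]
   carry the discrete sigma-algebra (the latter as a product). *)

Definition mutually_independent (d d' : measure_display)
    (T : measurableType d) (E : measurableType d') (R : realType)
    (P : probability T R) (I : eqType) (Y : I -> T -> E) : Prop :=
  forall (s : seq I) (B : I -> set E), uniq s ->
    (forall i, measurable (B i)) ->
    (P (\big[setI/setT]_(i <- s) (Y i @^-1` B i)) =
     \prod_(i <- s) P (Y i @^-1` B i))%E.

Definition identically_distributed (d d' : measure_display)
    (T : measurableType d) (E : measurableType d') (R : realType)
    (P : probability T R) (Y Z : T -> E) : Prop :=
  forall B : set E, measurable B -> P (Y @^-1` B) = P (Z @^-1` B).

Section GaltonWatson.
Context {p : nat}.
Notation vec := (p.-tuple nat).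

(* One generation: from the population [x], where the [l]-th individual of
   type [i] has offspring vector [xi l i], with immigrants [e]. *)
Definition gwi_step (x : vec) (xi : nat -> 'I_p -> vec) (e : vec) : vec :=
  [tuple ((\sum_(i < p) \sum_(l < tnth x i) tnth (xi l i) j) + tnth e j)%N
  | j < p].

Context {d : measure_display} {T : measurableType d} {R : realType}.
Variable P : probability T R.

(* X_0, the offspring vectors (indexed by generation, individual, type) and
   the immigration vectors (indexed by generation), as a single family. *)
Definition gwi_inputs (X0 : T -> vec) (xi : nat -> nat -> 'I_p -> T -> vec)
    (eps : nat -> T -> vec) (k : unit + (nat * nat * 'I_p) + nat) : T -> vec :=
  match k with
  | inl (inl tt) => X0
  | inl (inr (k, l, i)) => xi k l i
  | inr k => eps k
  end.

(* The indices k, l >= 1 of the offspring and immigration vectors are shifted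
   to start at 0: [xi k l i] is the vector xi^(i)_{k+1,l+1}, and [eps k] is
   eps_{k+1}. *)
Record is_gwi (X : nat -> {RV P >-> vec})
    (xi : nat -> nat -> 'I_p -> {RV P >-> vec}) (eps : nat -> {RV P >-> vec})
    (xi_gen : 'I_p -> {RV P >-> vec}) (eps_gen : {RV P >-> vec}) : Prop := {
  gwi_rec : forall k w,
    X k.+1 w = gwi_step (X k w) (fun l i => xi k l i w) (eps k w) ;
  gwi_indep : mutually_independent P
    (gwi_inputs (X 0%N) (fun k l i => xi k l i) (fun k => eps k)) ;
  gwi_xi_law : forall k l i, identically_distributed P (xi k l i) (xi_gen i) ;
  gwi_eps_law : forall k, identically_distributed P (eps k) eps_gen }.

(* One-step transition kernel of the chain (X_k): the law of a generation
   whose parent generation is [x]. *)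
Definition gwi_kernel (xi : nat -> nat -> 'I_p -> {RV P >-> vec})
    (eps : nat -> {RV P >-> vec}) (x : vec) (B : set vec) : \bar R :=
  P [set w | B (gwi_step x (fun l i => xi 0%N l i w) (eps 0%N w))].

Definition stationary (K : vec -> set vec -> \bar R)
    (pi : probability vec R) : Prop :=
  forall B : set vec, measurable B -> (\int[pi]_x K x B = pi B)%E.

Definition coord (Y : T -> vec) (j : 'I_p) : T -> R :=
  fun w => (tnth (Y w) j)%:R.

Definition finite_mean (Y : T -> vec) : Prop :=
  forall j, ('E_P[coord Y j] < +oo)%E.

Definition mean_vec (Y : T -> vec) : 'cV[R]_p :=
  \col_j fine ('E_P[coord Y j])%E.

Definition mean_mx (xi_gen : 'I_p -> T -> vec) : 'M[R]_p :=
  \matrix_(j, i) mean_vec (xi_gen i) j 0.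

End GaltonWatson.

(* All mixed moments of order [alpha] are finite; they are integrals of
   nonnegative functions, hence always defined in [0, +oo]. *)
Definition finite_moment {p : nat} {R : realType}
    (mu : {measure set (p.-tuple nat) -> \bar R}) (alpha : nat) : Prop :=
  forall a : 'I_p -> nat, (\sum_(j < p) a j)%N = alpha ->
    (\int[mu]_x (\prod_(j < p) (tnth x j)%:R ^+ a j)%:E < +oo)%E.

Definition spectral_radius {R : realType} {p : nat} (M : 'M[R]_p) : R :=
  sup [set complex.Re `|z| | z in
        [set z : R[i] | eigenvalue (map_mx (real_complex R) M) z]].

Definition primitive_mx {R : realType} {p : nat} (M : 'M[R]_p) : Prop :=
  exists2 n : nat, (0 < n)%N & forall i j, 0 < (M ^+ n) i j.

(* Main.v *)
Require Import Defs.
From HB Require Import structures.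
From mathcomp Require Import all_boot all_order all_algebra.
From mathcomp Require Import all_classical all_reals all_analysis.
From mathcomp Require Import measurable_realfun complex ring lra.

(** The proof is a Foster-Lyapunov argument for the stationarity identity.

    Let M be the mean matrix.  As its spectral radius is below 1, the row vector
    v = (1, ..., 1) (I - M)^-1 exists; it is at least 1 in each coordinate
    and v M = v - 1 ([subinvariant_weight]).  With V(x) = (1 + v.x)^alpha, each
    mixed monomial of order alpha is at most V, so it suffices to integrate V.

    Given a parent generation x, the quantity S = 1 + v.X_1 is 1 plus a sum of
    independent nonnegative variables, one for each individual and one for the
    immigrants.  Isolating one summand at a time gives the recursion
    E S^(k+2) <= E S * E S^(k+1) + T * E S^k, where T collects higher
    moments of the summands ([shifted_sum_moment_rec]).  With y = 1 + v.x, both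
    E S <= l y + b for a rate l < 1, because v M = v - 1, and T <= c y hold.
    Induction on k then gives E S^alpha <= l^alpha y^alpha + C y^(alpha-1)
    ([two_term_moment_bound]), that is, a drift inequality
    K V <= r V + B with r < 1 ([gwi_weight_drift]).

    Integrating the drift inequality directly against [pi] would be circular
    when the integral of V is infinite, so it is applied to the truncations
    min(V, n): stationarity cancels the finite mass of V > n and leaves
    (1 - r) times the integral of V over V <= n at most B, for each n
    ([stationary_drift_bound]). *)

Set Implicit Arguments.
Unset Strict Implicit.
Unset Printing Implicit Defensive.
Import Order.TTheory GRing.Theory Num.Theory.
Import numFieldNormedType.Exports.

Local Open Scope classical_set_scope.
Local Open Scope ring_scope.

(** * A subinvariant weight for the mean matrix *)

Lemma eigenvalue_le_spectral_radius (R : realType) (p : nat) (M : 'M[R]_p)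
    (t : R) : 0 <= t -> eigenvalue M t -> t <= spectral_radius M.
Proof.
move=> t0 Mt; rewrite /spectral_radius.
have absE (z : R[i]) : complex.Re `|z| =
    Num.sqrt (complex.Re z ^+ 2 + complex.Im z ^+ 2).
  by rewrite normc_def.
apply: ub_le_sup; last first.
  exists (real_complex R t); first by rewrite /= eigenvalue_map.
  by rewrite absE /= expr0n addr0 sqrtr_sqr ger0_norm.
(* The eigenvalues are the finitely many roots of the characteristic
   polynomial, so the sum of their moduli bounds the set. *)
have [zs zsE] :=
  closed_field_poly_normal (char_poly (map_mx (real_complex R) M)).
pose a (z : R[i]) := Num.sqrt (complex.Re z ^+ 2 + complex.Im z ^+ 2).
have a0 z : 0 <= a z by exact: sqrtr_ge0.
exists (\sum_(z <- (zs : seq R[i])) a z) => _ [z zM <-].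
rewrite absE -/(a z); move: zM => /=.
rewrite eigenvalue_root_char zsE.
rewrite (monicP (char_poly_monic _)) scale1r root_prod_XsubC => zzs.
rewrite (big_rem z zzs) lerDl; apply: sumr_ge0 => y _; exact: a0.
Qed.

Lemma continuous_bigmin (R : realType) (I : Type) (s : seq I) (c : R)
    (f : I -> R -> R) :
  (forall i, continuous (f i)) ->
  continuous (fun t => \big[Num.min/c]_(i <- s) f i t).
Proof.
move=> fc; elim: s => [|i s IH] t.
  under [X in continuous_at _ X]eq_fun do rewrite big_nil.
  exact: cvg_cst.
under [X in continuous_at _ X]eq_fun do rewrite big_cons.
by apply: continuous_min; [exact: fc|exact: IH].
Qed.

(** The resolvent vector v(t) = (1, ..., 1) (t I - M)^-1 has no pole for t >= 1,
    since real eigenvalues of M are below 1.  It is nonnegative for t large,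
    and at any t >= 1 where it is nonnegative it is in fact positive, because
    t v = 1 + v M.  Hence its least coordinate cannot reach 0 on the way down
    to t = 1.  In the proof [d] is the characteristic polynomial and [q] is
    d^2 v, so that only polynomials in t occur. *)
Lemma subinvariant_weight (R : realType) (p : nat) (M : 'M[R]_p) :
  (forall i j, 0 <= M i j) -> spectral_radius M < 1 ->
  exists v : 'I_p -> R,
    (forall j, 1 <= v j) /\ (forall j, \sum_i v i * M i j = v j - 1).
Proof.
move=> M0 rM.
pose d : {poly R} := char_poly M.
pose q j : {poly R} := d * \sum_i (\adj (char_poly_mx M)) i j.
have dt t : 1 <= t -> d.[t] != 0.
  move=> t1; apply/negP => dt0.
  suff : t <= spectral_radius M.
    by move=> /le_lt_trans/(_ rM)/(le_lt_trans t1); rewrite ltxx.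
  apply: eigenvalue_le_spectral_radius; first exact: le_trans t1.
  by rewrite eigenvalue_root_char /root.
(* The resolvent identity t v = v M + 1, multiplied by d^2. *)
have qE t j : t * (q j).[t] = \sum_i (q i).[t] * M i j + d.[t] ^+ 2.
  have E : 'X * q j = \sum_i q i * (M i j)%:P + d ^+ 2.
    have : (const_mx d : 'rV_p) *m (\adj (char_poly_mx M) *m char_poly_mx M)
         = (const_mx d : 'rV_p) *m (\det (char_poly_mx M))%:M
      by rewrite mul_adj_mx.
    rewrite mulmxA mul_mx_scalar => /matrixP/(_ ord0 j).
    rewrite mxE [in RHS]mxE mxE -/(char_poly M) -/d => E.
    rewrite expr2 -E -big_split /=.
    rewrite (eq_bigr (fun i => q i * ('X *+ (i == j)))); last first.
      move=> i _; rewrite mxE !mxE.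
      rewrite (_ : \sum_j0 _ = q i); last first.
        by rewrite /q mulr_sumr; apply: eq_bigr => k _; rewrite mxE.
      by rewrite -mulrDr addrCA subrr addr0.
    rewrite (bigD1 j isT) /= eqxx mulr1n big1 => [|i /negPf ->].
      by rewrite addr0 mulrC.
    by rewrite mulr0n mulr0.
  move/(congr1 (horner^~ t)): E.
  rewrite hornerM hornerX hornerD horner_exp horner_sum.
  by under eq_bigr do rewrite hornerM hornerC.
have qpos t : 1 <= t -> (forall j, 0 <= (q j).[t]) -> forall j, 0 < (q j).[t].
  move=> t1 q0 j; have t0 : 0 < t by exact: lt_le_trans t1.
  rewrite -(pmulr_rgt0 _ t0) qE ltr_wpDl//.
    by apply: sumr_ge0 => i _; exact: mulr_ge0.
  by rewrite exprn_even_gt0//= dt.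
pose g t := \big[Num.min/1]_j (q j).[t].
have gc : continuous g.
  by apply: continuous_bigmin => j; exact: continuous_horner.
(* Beyond all column sums of M, a negative least coordinate of v(t) would
   contradict t v = 1 + v M. *)
pose b := 1 + \sum_i \sum_j M i j.
have b1 : 1 <= b by rewrite lerDl; apply: sumr_ge0 => i _; apply: sumr_ge0.
have gb : 0 < g b.
  apply: lt_bigmin => // j _; apply: qpos => // {}j.
  case: (@arg_minP _ _ _ j xpredT (fun j => (q j).[b]) isT) => k _ kmin.
  apply: le_trans (kmin j isT); rewrite leNgt; apply/negP => qk.
  have := qE b k; apply/eqP; rewrite lt_eqF//.
  apply: (@le_lt_trans _ _ (\sum_i (q k).[b] * M i k)); last first.
    rewrite (@le_lt_trans _ _ (\sum_i (q i).[b] * M i k))//.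
      by apply: ler_sum => i _; rewrite ler_wpM2r// kmin.
    by rewrite ltrDl exprn_even_gt0//= dt.
  rewrite -mulr_sumr mulrC ler_wnM2l//; first exact: ltW.
  rewrite /b -[leLHS]add0r lerD//; apply: ler_sum => i _.
  by rewrite (bigD1 k)//= lerDl sumr_ge0.
have g1 : 0 < g 1.
  rewrite ltNge; apply/negP => g1.
  have [||c /[1!in_itv]/= /andP[c1 _] gc0] := @IVT R g 1 b 0 b1.
  - exact: continuous_subspaceT.
  - by rewrite minEle maxEle !(le_trans g1 (ltW gb)) g1 ltW.
  have q0 j : 0 <= (q j).[c] by rewrite -gc0; exact: bigmin_le.
  suff : 0 < g c by rewrite gc0 ltxx.
  by apply: lt_bigmin => // j _; exact: qpos.
have q1 j : 0 < (q j).[1] by apply: lt_le_trans g1 _; exact: bigmin_le.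
have d2 : 0 < d.[1] ^+ 2 by rewrite exprn_even_gt0//= dt.
pose v j := (q j).[1] / d.[1] ^+ 2.
have vE j : \sum_i v i * M i j = v j - 1.
  rewrite /v -[(q j).[1]]mul1r qE mulrDl mulfV ?gt_eqF// addrK mulr_suml.
  by apply: eq_bigr => i _; rewrite mulrAC.
exists v; split => // j.
rewrite -subr_ge0 -vE; apply: sumr_ge0 => i _.
by rewrite mulr_ge0// divr_ge0// ltW.
Qed.

(** * Integrals of functions of a random tuple of naturals *)

(** Singletons are finite intersections of coordinate cylinders, and there are
    countably many tuples. *)
Lemma measurable_nat_tuple (p : nat) (A : set (p.-tuple nat)) : measurable A.
Proof.
apply: countable_measurable; last exact: countableP.
move=> t; rewrite (_ : [set t] =
    \big[setI/setT]_(i < p) ((tnth (T:=nat))^~ i @^-1` [set tnth t i])).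
  apply: bigsetI_measurable => i _; rewrite -[X in measurable X]setTI.
  exact: measurable_tnth.
rewrite -bigcap_seq.
apply/seteqP; split => [_ -> i _ //|s st].
by apply: eq_from_tnth => i; apply: (st i); rewrite /= mem_index_enum.
Qed.

Lemma measurable_fun_nat_tuple (p : nat) d (U : measurableType d)
    (D : set (p.-tuple nat)) (f : p.-tuple nat -> U) : measurable_fun D f.
Proof. by move=> _ B mB; exact: measurable_nat_tuple. Qed.

(** Enumerating the tuples by their codes turns integrals of functions of a
    random tuple into series; the default value is used at numbers that code
    no tuple, where the corresponding event is empty. *)
Definition tuple_of_code (p n : nat) : p.-tuple nat :=
  odflt [tuple 0%N | _ < p] (unpickle n).

Definition code_set (p n : nat) : set (p.-tuple nat) :=
  [set y | pickle y = n].

Lemma code_setE (p n : nat) (y : p.-tuple nat) :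
  code_set n y -> y = tuple_of_code p n.
Proof. by move=> <-; rewrite /tuple_of_code pickleK. Qed.

Lemma bigcup_code_set (p : nat) (T : Type) (Y : T -> p.-tuple nat) (D : set T) :
  \bigcup_n (D `&` Y @^-1` code_set n) = D.
Proof.
apply/seteqP; split => [w [n _ []] //|w Dw].
by exists (pickle (Y w)).
Qed.

Lemma trivIset_code_set (p : nat) (T : Type) (Y : T -> p.-tuple nat)
    (D : set T) :
  trivIset setT (fun n => D `&` Y @^-1` code_set n).
Proof. by move=> i j _ _ [w [[_ <-] [_ <-]]]. Qed.

Lemma measurable_code_set (p n : nat) d (T : measurableType d)
    (Y : T -> p.-tuple nat) (D : set T) :
  measurable D -> measurable_fun setT Y ->
  measurable (D `&` Y @^-1` code_set n).
Proof.
move=> mD mY; apply: measurableI => //; rewrite -[X in measurable X]setTI.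
by apply: mY => //; exact: measurable_nat_tuple.
Qed.

Lemma measurable_fun_code (p : nat) d (T : measurableType d) d'
    (U : measurableType d') (Y : T -> p.-tuple nat)
    (H : p.-tuple nat -> T -> U) :
  measurable_fun setT Y -> (forall y, measurable_fun setT (H y)) ->
  measurable_fun setT (fun w => H (Y w) w).
Proof.
move=> mY mH; rewrite -(bigcup_code_set Y setT).
apply/measurable_fun_bigcup => n; first exact: measurable_code_set.
apply: (@eq_measurable_fun _ _ _ _ _ (H (tuple_of_code p n))).
  by move=> w /[!inE] -[_ /= /code_setE <-].
exact: measurable_funTS.
Qed.

(** The form with a second argument in [H] is what conditioning on the value of
    [Y] amounts to: on each piece the first argument is frozen, while [H] may
    still depend on other variables. *)
Lemma ge0_integral_code (p : nat) (R : realType) d (T : measurableType d)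
    (mu : {measure set T -> \bar R}) (Y : T -> p.-tuple nat) (D : set T)
    (H : p.-tuple nat -> T -> \bar R) :
  measurable D -> measurable_fun setT Y ->
  (forall y w, 0 <= H y w)%E -> (forall y, measurable_fun setT (H y)) ->
  (\int[mu]_(w in D) H (Y w) w = \sum_(0 <= n <oo)
     \int[mu]_(w in D `&` Y @^-1` code_set n) H (tuple_of_code p n) w)%E.
Proof.
move=> mD mY H0 mH; rewrite -[in LHS](bigcup_code_set Y D).
rewrite ge0_integral_bigcup//.
- apply: eq_eseriesr => n _; apply: eq_integral => w /[!inE] -[_ /=].
  by move=> /code_setE ->.
- by move=> n; exact: measurable_code_set.
- by apply: measurable_funTS; exact: measurable_fun_code.
- exact: trivIset_code_set.
Qed.

Lemma ge0_integral_law (p : nat) (R : realType) d (T : measurableType d)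
    (mu : {measure set T -> \bar R}) (Y : T -> p.-tuple nat)
    (f : p.-tuple nat -> \bar R) :
  measurable_fun setT Y -> (forall y, 0 <= f y)%E ->
  (\int[mu]_w f (Y w) = \sum_(0 <= n <oo)
     f (tuple_of_code p n) * mu (Y @^-1` code_set n))%E.
Proof.
move=> mY f0.
rewrite (@ge0_integral_code _ _ _ _ mu Y setT (fun y _ => f y))//.
apply: eq_eseriesr => n _; rewrite setTI integral_cst//.
by rewrite -[X in measurable X]setTI; exact: measurable_code_set.
Qed.

Lemma eq_law_integral (p : nat) (R : realType) d (T : measurableType d)
    (P : probability T R) (Y Z : T -> p.-tuple nat)
    (f : p.-tuple nat -> \bar R) :
  measurable_fun setT Y -> measurable_fun setT Z ->
  identically_distributed P Y Z -> (forall y, 0 <= f y)%E ->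
  (\int[P]_w f (Y w) = \int[P]_w f (Z w))%E.
Proof.
move=> mY mZ YZ f0; rewrite !ge0_integral_law//.
apply: eq_eseriesr => n _; congr (_ * _)%E; apply: YZ.
exact: measurable_nat_tuple.
Qed.

(** * Independence of block sums *)

(** This is the invariant of the induction over [s] in
    [integral_sum_event_indep]: the values already revealed are gathered in the
    event [A], which must stay independent of the variables still to come. *)
Definition event_indep (p : nat) (R : realType) d (T : measurableType d)
    (P : probability T R) (I : eqType) (Y : I -> T -> p.-tuple nat)
    (A : set T) (s : seq I) : Prop :=
  forall B : I -> set (p.-tuple nat),
    (P (A `&` \big[setI/setT]_(i <- s) (Y i @^-1` B i)) =
     P A * \prod_(i <- s) P (Y i @^-1` B i))%E.

Lemma event_indep_setT (p : nat) (R : realType) d (T : measurableType d)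
    (P : probability T R) (I : eqType) (Y : I -> T -> p.-tuple nat)
    (s : seq I) :
  mutually_independent P Y -> uniq s -> event_indep P Y setT s.
Proof.
move=> iY us B; rewrite setTI probability_setT mul1e iY// => i.
exact: measurable_nat_tuple.
Qed.

Lemma event_indep_cons (p : nat) (R : realType) d (T : measurableType d)
    (P : probability T R) (I : eqType) (Y : I -> T -> p.-tuple nat)
    (A : set T) (b : I) (s : seq I) (C : set (p.-tuple nat)) :
  uniq (b :: s) -> event_indep P Y A (b :: s) ->
  P (A `&` Y b @^-1` C) = (P A * P (Y b @^-1` C))%E /\
  event_indep P Y (A `&` Y b @^-1` C) s.
Proof.
move=> /= /andP[bs us] iA.
have E B : P (A `&` Y b @^-1` C `&` \big[setI/setT]_(i <- s) (Y i @^-1` B i))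
    = (P A * (P (Y b @^-1` C) * \prod_(i <- s) P (Y i @^-1` B i)))%E.
  have sb i : i \in s -> (i == b) = false.
    by move=> si; apply: contraNF bs => /eqP <-.
  have := iA (fun i => if i == b then C else B i).
  rewrite !big_cons eqxx setIA.
  rewrite (eq_big_seq (fun i => Y i @^-1` B i)) => [->|i /sb -> //].
  by congr (_ * (_ * _))%E; apply: eq_big_seq => i /sb ->.
have E1 : P (A `&` Y b @^-1` C) = (P A * P (Y b @^-1` C))%E.
  have := E (fun=> setT).
  rewrite !big1 ?setIT ?mule1// => i _;
    by rewrite preimage_setT ?probability_setT.
by split => // B; rewrite E E1 muleA.
Qed.

(** A function of a block sum is independent of any event that is independent
    of the block.  The value of the head of the block is revealed, which
    enlarges [A] and shifts the argument of [F]; this is why [F] is arbitrary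
    in the induction. *)
Lemma integral_sum_event_indep (p : nat) (R : realType) d
    (T : measurableType d) (P : probability T R) (I : eqType)
    (Y : I -> T -> p.-tuple nat) (h : p.-tuple nat -> R) (s : seq I)
    (A : set T) (F : R -> \bar R) :
  (forall i, measurable_fun setT (Y i)) -> mutually_independent P Y ->
  uniq s -> measurable A -> event_indep P Y A s ->
  measurable_fun setT F -> (forall x, 0 <= F x)%E ->
  (\int[P]_(w in A) F (\sum_(i <- s) h (Y i w))%R =
   P A * \int[P]_w F (\sum_(i <- s) h (Y i w))%R)%E.
Proof.
move=> mY iY; elim: s A F => [|b s IH] A F us mA iA mF F0.
  under eq_integral do rewrite big_nil.
  under [in RHS]eq_integral do rewrite big_nil.
  rewrite integral_cst// integral_cst//.
  by have /= -> := probability_setT P; rewrite mule1 muleC.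
have /andP[_ us'] : (b \notin s) && uniq s by [].
have mhY i : measurable_fun setT (fun w => h (Y i w)).
  by apply: measurableT_comp => //; exact: measurable_fun_nat_tuple.
have mS : measurable_fun setT (fun w => \sum_(i <- s) h (Y i w)).
  exact: measurable_sum.
have mFy y : measurable_fun setT (fun x => F (h y + x)).
  by apply: measurableT_comp => //; exact: measurable_funD.
(* The same expansion is used for the given event and for the whole space:
   both sides then show the same series. *)
have E (A' : set T) : measurable A' -> event_indep P Y A' (b :: s) ->
    (\int[P]_(w in A') F (\sum_(i <- b :: s) h (Y i w))%R =
     P A' * \sum_(0 <= n <oo) (P (Y b @^-1` code_set n) *
       \int[P]_w F (h (tuple_of_code p n) + \sum_(i <- s) h (Y i w))%R))%E.
  move=> mA' iA'; under eq_integral do rewrite big_cons.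
  rewrite (@ge0_integral_code _ _ _ _ P (Y b) A'
    (fun y w => F (h y + \sum_(i <- s) h (Y i w)))) //; last first.
    by move=> y; apply: (measurableT_comp (mFy y)).
  rewrite -(fineK (fin_num_measure P A' mA')) -nneseriesZl; last first.
    by move=> n _; rewrite mule_ge0// integral_ge0.
  apply: eq_eseriesr => n _; rewrite fineK ?fin_num_measure//.
  have [E1 E2] := event_indep_cons (code_set n) us iA'.
  rewrite [LHS](IH _ (fun x => F (h (tuple_of_code p n) + x))) ?E1 ?muleA//.
  exact: measurable_code_set.
rewrite E// E ?probability_setT ?mul1e//.
exact: event_indep_setT.
Qed.

Lemma integral_mul_indep_sum (p : nat) (R : realType) d
    (T : measurableType d) (P : probability T R) (I : eqType)
    (Y : I -> T -> p.-tuple nat) (h : p.-tuple nat -> R) (b : I) (s : seq I)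
    (g : p.-tuple nat -> \bar R) (F : R -> \bar R) :
  (forall i, measurable_fun setT (Y i)) -> mutually_independent P Y ->
  uniq (b :: s) -> (forall y, 0 <= g y)%E ->
  measurable_fun setT F -> (forall x, 0 <= F x)%E ->
  (\int[P]_w (g (Y b w) * F (\sum_(i <- s) h (Y i w))%R) =
   \int[P]_w g (Y b w) * \int[P]_w F (\sum_(i <- s) h (Y i w))%R)%E.
Proof.
move=> mY iY us g0 mF F0.
have mhY i : measurable_fun setT (fun w => h (Y i w)).
  by apply: measurableT_comp => //; exact: measurable_fun_nat_tuple.
have mFS : measurable_fun setT (fun w => F (\sum_(i <- s) h (Y i w))).
  by apply: measurableT_comp => //; exact: measurable_sum.
rewrite -ge0_integralZr//; last 2 first.
- by apply: measurableT_comp => //; exact: measurable_fun_nat_tuple.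
- exact: integral_ge0.
rewrite (@ge0_integral_code _ _ _ _ P (Y b) setT
  (fun y w => g y * F (\sum_(i <- s) h (Y i w))%R)%E)//; last 2 first.
- by move=> y w; exact: mule_ge0.
- by move=> y; apply: emeasurable_funM.
rewrite (@ge0_integral_code _ _ _ _ P (Y b) setT
  (fun y w => g y * \int[P]_w F (\sum_(i <- s) h (Y i w))%R)%E)//; last first.
  by move=> y w; rewrite mule_ge0// integral_ge0.
apply: eq_eseriesr => n _; rewrite ge0_integralZl//; last 2 first.
- exact: measurable_code_set.
- exact: measurable_funTS.
rewrite integral_cst; last exact: measurable_code_set.
have [E1 E2] := event_indep_cons (code_set n) us (event_indep_setT iY us).
rewrite -[RHS]muleA; congr (_ * _)%E; rewrite [RHS]muleC.
apply: (integral_sum_event_indep h) => //; last exact: measurable_code_set.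
by case/andP: us.
Qed.

(** * Moments of sums of independent variables *)

(** Only the term of top degree in [r] must be kept sharp, as it yields the
    leading constant of the moment bound; since [1 <= r], the other terms of
    the binomial expansion are all absorbed by [r ^+ k]. *)
Lemma ler_mul_exprDn (R : realFieldType) (x r : R) (k : nat) :
  0 <= x -> 1 <= r ->
  x * (x + r) ^+ k.+1 <= x * r ^+ k.+1 + x * (1 + x) ^+ k.+1 * r ^+ k.
Proof.
move=> x0 r1; rewrite -mulrA -mulrDr ler_wpM2l//.
suff H n : (x + r) ^+ n * r <= r ^+ n.+1 + ((1 + x) ^+ n - 1) * r ^+ n.
  have r0 : 0 < r by exact: lt_le_trans r1.
  rewrite -(ler_pM2r r0); apply: le_trans (H k.+1) _.
  rewrite [leRHS]mulrDl -[_ * r ^+ k * r]mulrA -!exprSr lerD2l ler_wpM2r//.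
    by rewrite exprn_ge0// ltW.
  by rewrite gerBl.
elim: n => [|n IH]; first by rewrite !expr0 subrr mul0r mul1r addr0 expr1.
have r0 : 0 <= r by exact: le_trans r1.
rewrite exprS -mulrA; apply: le_trans (ler_wpM2l _ IH) _; first exact: addr_ge0.
have q1 : 1 <= (1 + x) ^+ n by rewrite exprn_ege1// lerDl.
have P0 : 0 <= r ^+ n by exact: exprn_ge0.
rewrite !exprS; set q := (1 + x) ^+ n in q1 *; set s := r ^+ n in P0 *.
rewrite -subr_ge0 [X in 0 <= X](_ : _ = (q - 1) * x * (s * (r - 1)));
  last by ring.
by rewrite !mulr_ge0// subr_ge0.
Qed.

(** The 1 keeps the sum, and what is left of it without one summand, at
    least 1, as [ler_mul_exprDn] requires. *)
Definition shifted_sum (p : nat) (R : realType) (T : Type) (I : Type)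
    (Y : I -> T -> p.-tuple nat) (h : p.-tuple nat -> R) (s : seq I)
    (w : T) : R :=
  1 + \sum_(i <- s) h (Y i w).

(** With S the shifted sum, S^(k+2) is S^(k+1) plus the sum over i of
    h(Y_i) S^(k+1).  In the i-th term, S is h(Y_i) plus a sum Q that is
    independent of Y_i, so [ler_mul_exprDn] applies, expectations factor, and
    the moments of Q are at most those of S. *)
Lemma shifted_sum_moment_rec (p : nat) (R : realType) d
    (T : measurableType d) (P : probability T R) (I : eqType)
    (Y : I -> T -> p.-tuple nat) (h : p.-tuple nat -> R) (s : seq I) (k : nat) :
  (forall i, measurable_fun setT (Y i)) -> mutually_independent P Y ->
  (forall y, 0 <= h y) -> uniq s ->
  (\int[P]_w (shifted_sum Y h s w ^+ k.+2)%:E <=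
   (1 + \sum_(i <- s) \int[P]_w (h (Y i w))%:E) *
      \int[P]_w (shifted_sum Y h s w ^+ k.+1)%:E +
   (\sum_(i <- s) \int[P]_w (h (Y i w) * (1 + h (Y i w)) ^+ k.+1)%:E) *
      \int[P]_w (shifted_sum Y h s w ^+ k)%:E)%E.
Proof.
move=> mY iY h0 us; set S := shifted_sum Y h s.
have mf (f : p.-tuple nat -> R) i : measurable_fun setT (fun w => f (Y i w)).
  by apply: measurableT_comp => //; exact: measurable_fun_nat_tuple.
have mS r : measurable_fun setT (shifted_sum Y h r).
  by apply: measurable_funD => //; exact: measurable_sum.
have mSX r n : measurable_fun setT (fun w => shifted_sum Y h r w ^+ n).
  by apply: measurable_funX; exact: mS.
have S1 r w : 1 <= shifted_sum Y h r w.
  by rewrite lerDl; apply: sumr_ge0.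
have P0 r w : 0 <= shifted_sum Y h r w by exact: le_trans (S1 r w).
have S0 r w n : 0 <= shifted_sum Y h r w ^+ n by exact: exprn_ge0.
pose F n (x : R) := (`|1 + x| ^+ n)%:E.
have mF n : measurable_fun setT (F n).
  apply/measurable_EFinP; apply: measurable_funX.
  by apply: measurableT_comp => //; exact: measurable_funD.
have F0 n x : (0 <= F n x)%E by rewrite lee_fin exprn_ge0.
have FE r n w : F n (\sum_(i <- r) h (Y i w)) = (shifted_sum Y h r w ^+ n)%:E.
  by rewrite /F ger0_norm// (le_trans _ (S1 r w)).
have key i : i \in s -> (\int[P]_w (h (Y i w) * S w ^+ k.+1)%:E <=
    \int[P]_w (h (Y i w))%:E * \int[P]_w (S w ^+ k.+1)%:E +
    \int[P]_w (h (Y i w) * (1 + h (Y i w)) ^+ k.+1)%:E *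
    \int[P]_w (S w ^+ k)%:E)%E.
  move=> si; pose Q := shifted_sum Y h (rem i s).
  have SE w : S w = h (Y i w) + Q w.
    by rewrite /S /shifted_sum (big_rem i si) /= addrCA.
  have ui : uniq (i :: rem i s).
    by rewrite /= rem_uniq// mem_rem_uniq// inE eqxx.
  have QS n : (\int[P]_w (Q w ^+ n)%:E <= \int[P]_w (S w ^+ n)%:E)%E.
    apply: ge0_le_integral => //.
    - by move=> w _; rewrite lee_fin S0.
    - by apply/measurable_EFinP; exact: mSX.
    - by apply/measurable_EFinP; exact: mSX.
    - move=> w _; rewrite lee_fin; apply: lerXn2r; rewrite ?nnegrE.
      + exact: P0.
      + exact: P0.
      + by rewrite SE lerDr.
  have split_i (g : p.-tuple nat -> R) n : (forall y, 0 <= g y) ->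
      (\int[P]_w (g (Y i w) * Q w ^+ n)%:E <=
       \int[P]_w (g (Y i w))%:E * \int[P]_w (S w ^+ n)%:E)%E.
    move=> g0; under eq_integral do rewrite EFinM -FE.
    rewrite (@integral_mul_indep_sum _ _ _ _ P _ Y h i _ (fun y => (g y)%:E))//.
    under [X in (_ * X <= _)%E]eq_integral do rewrite FE.
    apply: lee_wpmul2l; last exact: QS.
    by apply: integral_ge0 => w _; rewrite lee_fin.
  apply: (@le_trans _ _ (\int[P]_w ((h (Y i w) * Q w ^+ k.+1)%:E +
      (h (Y i w) * (1 + h (Y i w)) ^+ k.+1 * Q w ^+ k)%:E))%E).
    apply: ge0_le_integral => //.
    - by move=> w _; rewrite lee_fin mulr_ge0// S0.
    - apply/measurable_EFinP; apply: measurable_funM; first exact: mf.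
      exact: mSX.
    - apply: emeasurable_funD; apply/measurable_EFinP; apply: measurable_funM.
      + exact: mf.
      + exact: mSX.
      + exact: (mf (fun y => h y * (1 + h y) ^+ k.+1)).
      + exact: mSX.
    - by move=> w _; rewrite -EFinD lee_fin SE ler_mul_exprDn// S1.
  rewrite ge0_integralD//; first last.
  - apply/measurable_EFinP; apply: measurable_funM.
    + exact: (mf (fun y => h y * (1 + h y) ^+ k.+1)).
    + exact: mSX.
  - by move=> w _; rewrite lee_fin !mulr_ge0// ?S0// exprn_ge0// addr_ge0.
  - apply/measurable_EFinP; apply: measurable_funM; first exact: mf.
    exact: mSX.
  - by move=> w _; rewrite lee_fin !mulr_ge0// ?S0.
  apply: leeD; first exact: split_i.
  apply: (split_i (fun y => h y * (1 + h y) ^+ k.+1)) => y.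
  by rewrite mulr_ge0// exprn_ge0// addr_ge0.
have SE w : ((S w ^+ k.+2)%:E =
    (S w ^+ k.+1)%:E + \sum_(i <- s) (h (Y i w) * S w ^+ k.+1)%:E)%E.
  by rewrite sumEFin -EFinD -mulr_suml exprS {1}/S /shifted_sum mulrDl mul1r.
under eq_integral do rewrite SE.
have mhS i : measurable_fun setT (fun w => (h (Y i w) * S w ^+ k.+1)%:E).
  apply/measurable_EFinP; apply: measurable_funM; first exact: mf.
  exact: mSX.
have hS0 i w : (0 <= (h (Y i w) * S w ^+ k.+1)%:E)%E.
  by rewrite lee_fin mulr_ge0// S0.
rewrite ge0_integralD//; first last.
- exact: emeasurable_sum.
- by move=> w _; apply: sume_ge0 => i _.
- by apply/measurable_EFinP; exact: mSX.
- by move=> w _; rewrite lee_fin S0.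
rewrite ge0_integral_sum//.
have I0 (f : T -> R) : (forall w, 0 <= f w) -> (0 <= \int[P]_w (f w)%:E)%E.
  by move=> f0; apply: integral_ge0 => w _; rewrite lee_fin.
rewrite ge0_muleDl//; last by apply: sume_ge0 => i _; exact: I0.
rewrite mul1e -[leRHS]addeA; apply: leeD2l.
rewrite !ge0_sume_distrl -?big_split /=.
- by rewrite !big_seq; apply: lee_sum => i; exact: key.
- by move=> i _; apply: I0 => w; rewrite mulr_ge0// exprn_ge0// addr_ge0.
- by move=> i _; exact: I0.
Qed.

(** The leading coefficient is multiplied by [l] at each step, and all other
    contributions are of order y^(k-1).  The constant is chosen before [u] and
    [y], as it must not depend on the parent generation. *)
Lemma two_term_moment_bound (R : realType) (l b c : R) (k : nat) :
  0 <= l <= 1 -> 0 <= b -> 0 <= c ->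
  exists2 C : R, 0 <= C & forall (u : nat -> \bar R) (y : R), 1 <= y ->
    (u 0%N <= 1)%E -> (u 1%N <= (l * y + b)%:E)%E ->
    (forall j, (j.+2 <= k)%N ->
      (u j.+2 <= (l * y + b)%:E * u j.+1 + (c * y)%:E * u j)%E) ->
    (u k <= (l ^+ k * y ^+ k + C * y ^+ k.-1)%:E)%E.
Proof.
move=> /andP[l0 l1] b0 c0.
have [n] := ubnP k; elim: n k => // n IH [|[|k]] kn.
- exists 0 => // u y _ u0 _ _.
  by rewrite !expr0 mul1r mul0r addr0.
- by exists b => // u y _ _ u1 _; rewrite !expr1 expr0 mulr1.
have [C1 C10 H1] := IH k.+1 kn.
have [C0 C00 H0] := IH k (ltnW kn).
exists (C1 + b + b * C1 + c * (1 + C0)).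
  by rewrite !addr_ge0// mulr_ge0// addr_ge0.
move=> u y y1 u0 u1 urec; have y0 : 0 <= y by exact: le_trans y1.
apply: le_trans (urec k (leqnn _)) _.
have {}H1 : (u k.+1 <= (l ^+ k.+1 * y ^+ k.+1 + C1 * y ^+ k)%:E)%E.
  by apply: H1 => // j jk; apply: urec; exact: ltnW.
have {}H0 : (u k <= ((1 + C0) * y ^+ k)%:E)%E.
  have := H0 u y y1 u0 u1 (fun j jk => urec j (leqW (leqW jk))).
  move/le_trans; apply; rewrite lee_fin mulrDl lerD//.
    by rewrite ler_wpM2r ?exprn_ge0// exprn_ile1.
  by rewrite ler_wpM2l// ler_weXn2l// leq_pred.
apply: (@le_trans _ _ ((l * y + b)%:E * (l ^+ k.+1 * y ^+ k.+1 + C1 * y ^+ k)%:E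
    + (c * y)%:E * ((1 + C0) * y ^+ k)%:E)%E).
  by apply: leeD; apply: lee_wpmul2l => //; rewrite lee_fin ?addr_ge0 ?mulr_ge0.
rewrite -!EFinM -EFinD lee_fin /= !exprS.
have L0 : 0 <= l ^+ k by exact: exprn_ge0.
have L1 : l ^+ k <= 1 by exact: exprn_ile1.
have Y0 : 0 <= y ^+ k by exact: exprn_ge0.
set L := l ^+ k in L0 L1 *; set Y := y ^+ k in Y0 *.
rewrite -subr_ge0 [X in 0 <= X](_ : _ = Y * (C1 * ((1 - l) * y) +
   b * y * (1 - l * L) + b * C1 * (y - 1))); last by ring.
apply: mulr_ge0 => //; rewrite !addr_ge0 ?mulr_ge0 ?subr_ge0//.
by rewrite mulr_ile1.
Qed.

(** * Drift inequalities and stationary laws *)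

Lemma stationary_integral (p : nat) (R : realType) d (T : measurableType d)
    (P : probability T R) (f : p.-tuple nat -> T -> p.-tuple nat)
    (pi : probability (p.-tuple nat) R) (g : p.-tuple nat -> \bar R) :
  (forall x, measurable_fun setT (f x)) ->
  stationary (fun x B => P [set w | B (f x w)]) pi ->
  (forall y, 0 <= g y)%E ->
  (\int[pi]_x g x = \int[pi]_x \int[P]_w g (f x w))%E.
Proof.
move=> mf st g0; rewrite (@ge0_integral_law _ _ _ _ pi id)//.
under [in RHS]eq_integral do rewrite ge0_integral_law//.
rewrite integral_nneseries//; last 2 first.
- by move=> n; exact: measurable_fun_nat_tuple.
- by move=> n x _; rewrite mule_ge0.
apply: eq_eseriesr => n _; rewrite ge0_integralZl//; last first.
  exact: measurable_fun_nat_tuple.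
congr (_ * _)%E; apply/esym/(st (code_set n)); exact: measurable_nat_tuple.
Qed.

(** For the truncation min(V, n), both sides of the stationarity identity are
    finite.  Its image under the kernel is at most l V + b and at most n; using
    the first bound where V <= n and the second elsewhere, the contribution of
    V > n is the same on both sides and cancels. *)
Lemma stationary_drift_bound (p : nat) (R : realType) d (T : measurableType d)
    (P : probability T R) (f : p.-tuple nat -> T -> p.-tuple nat)
    (pi : probability (p.-tuple nat) R) (V : p.-tuple nat -> R) (l b : R) :
  (forall x, measurable_fun setT (f x)) ->
  stationary (fun x B => P [set w | B (f x w)]) pi ->
  (forall y, 0 <= V y) -> 0 <= l < 1 -> 0 <= b ->
  (forall x, \int[P]_w (V (f x w))%:E <= (l * V x + b)%:E)%E ->
  (\int[pi]_x (V x)%:E <= (b / (1 - l))%:E)%E.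
Proof.
move=> mf st V0 /andP[l0 l1] b0 drift.
have mV D (g : p.-tuple nat -> \bar R) : measurable_fun D g.
  exact: measurable_fun_nat_tuple.
have mE D : measurable (D : set (p.-tuple nat)) by exact: measurable_nat_tuple.
pose A (n : nat) := [set x | V x <= n%:R].
have split_A n (g : p.-tuple nat -> \bar R) : (forall x, 0 <= g x)%E ->
    (\int[pi]_x g x = \int[pi]_(x in A n) g x + \int[pi]_(x in ~` A n) g x)%E.
  move=> g0; rewrite -ge0_integral_setU ?setUv//.
  by rewrite disj_set2E setICr.
have bound n : (\int[pi]_(x in A n) (V x)%:E <= (b / (1 - l))%:E)%E.
  pose g x := if V x <= n%:R then l * V x + b else n%:R.
  have g0 x : 0 <= g x.
    by rewrite /g; case: ifP => // _; rewrite addr_ge0// mulr_ge0.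
  have m0 x : 0 <= Num.min (V x) n%:R by rewrite le_min V0 ler0n.
  have : (\int[pi]_x (Num.min (V x) n%:R)%:E <= \int[pi]_x (g x)%:E)%E.
    rewrite (stationary_integral mf st); last by move=> y; rewrite lee_fin.
    apply: ge0_le_integral => //.
      by move=> x _; apply: integral_ge0 => w _; rewrite lee_fin.
    move=> x _; rewrite /g; case: ifP => _.
      apply: le_trans (drift x); apply: ge0_le_integral => //.
      - by move=> w _; rewrite lee_fin.
      - exact: (measurableT_comp
          (mV setT (fun y => (Num.min (V y) n%:R)%:E))).
      - by apply: (measurableT_comp (mV setT (fun y => (V y)%:E))).
      - by move=> w _; rewrite lee_fin ge_min lexx.
    apply: (@le_trans _ _ (\int[P]_w (cst n%:R%:E w))%E).
      apply: ge0_le_integral => //.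
      - by move=> w _; rewrite lee_fin.
      - exact: (measurableT_comp
          (mV setT (fun y => (Num.min (V y) n%:R)%:E))).
      - by move=> w _; rewrite lee_fin ge_min lexx orbT.
    by rewrite integral_cst//; have /= -> := probability_setT P; rewrite mule1.
  rewrite (split_A n) ?(split_A n (fun x => (g x)%:E)); last 2 first.
  - by move=> x; rewrite lee_fin.
  - by move=> x; rewrite lee_fin.
  have EA : (\int[pi]_(x in A n) (Num.min (V x) n%:R)%:E =
             \int[pi]_(x in A n) (V x)%:E)%E.
    by apply: eq_integral => x /[!inE] Ax; rewrite minEle ifT.
  have EAc : (\int[pi]_(x in ~` A n) (Num.min (V x) n%:R)%:E =
             \int[pi]_(x in ~` A n) (cst n%:R%:E x))%E.
    apply: eq_integral => x /[!inE] Ax; rewrite minEle ifF//.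
    by apply/negP.
  have EgA : (\int[pi]_(x in A n) (g x)%:E =
     l%:E * \int[pi]_(x in A n) (V x)%:E + b%:E * pi (A n))%E.
    rewrite -ge0_integralZl//; last by move=> x _; rewrite lee_fin.
    rewrite -integral_cst// -ge0_integralD//; last first.
      by move=> x _; rewrite lee_fin mulr_ge0.
    by apply: eq_integral => x /[!inE] Ax; rewrite /g ifT.
  have EgAc : (\int[pi]_(x in ~` A n) (g x)%:E =
             \int[pi]_(x in ~` A n) (cst n%:R%:E x))%E.
    apply: eq_integral => x /[!inE] Ax; rewrite /g ifF//.
    by apply/negP.
  rewrite EA EAc EgA EgAc integral_cst// leeD2rE; last first.
    by rewrite fin_numM// fin_num_measure.
  set J := (\int[pi]_(x in A n) (V x)%:E)%E.
  have Jfin : J \is a fin_num.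
    rewrite ge0_fin_numE; last by apply: integral_ge0 => x _; rewrite lee_fin.
    apply: (@le_lt_trans _ _ (\int[pi]_(x in A n) (cst n%:R%:E x))%E).
      by apply: ge0_le_integral => // x; rewrite lee_fin.
    rewrite integral_cst// ltey_eq fin_numM// fin_num_measure//.
  have piA : (b%:E * pi (A n) <= b%:E)%E.
    by rewrite -[leRHS]mule1 lee_wpmul2l ?lee_fin// probability_le1.
  move=> H; have {H piA} := le_trans H (leeD2l _ piA).
  rewrite -(fineK Jfin) -EFinM -EFinD !lee_fin => H.
  rewrite ler_pdivlMr ?subr_gt0//; lra.
have AT : \bigcup_n A n = setT.
  apply/seteqP; split => // x _; exists (Num.truncn (V x)).+1 => //=.
  by rewrite /A /=; apply/ltW; rewrite truncnS_gt.
have cv : (\int[pi]_(x in A n) (V x)%:E)%E @[n --> \oo] -->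
    (\int[pi]_x (V x)%:E)%E.
  rewrite -AT; apply: ge0_nondecreasing_set_cvg_integral => //.
  - move=> m n mn; apply/subsetPset => x; rewrite /A /= => /le_trans; apply.
    by rewrite ler_nat.
  - by move=> i x _; rewrite lee_fin.
rewrite -(cvg_lim _ cv)//; apply: lime_le; last exact: nearW.
by apply/cvg_ex; exists (\int[pi]_x (V x)%:E)%E.
Qed.

(** * Weights and moments *)

Definition weight (p : nat) (R : realType) (v : 'I_p -> R)
    (y : p.-tuple nat) : R :=
  \sum_(j < p) v j * (tnth y j)%:R.

Lemma weight_ge0 (p : nat) (R : realType) (v : 'I_p -> R) (y : p.-tuple nat) :
  (forall j, 1 <= v j) -> 0 <= weight v y.
Proof.
move=> v1; apply: sumr_ge0 => j _; rewrite mulr_ge0//.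
exact: le_trans (v1 j).
Qed.

Lemma tnth_le_weight (p : nat) (R : realType) (v : 'I_p -> R)
    (y : p.-tuple nat) (j : 'I_p) :
  (forall j, 1 <= v j) -> (tnth y j)%:R <= weight v y.
Proof.
move=> v1; rewrite /weight (bigD1 j)//= -[leLHS]addr0 lerD ?ler_peMl//.
by apply: sumr_ge0 => i _; rewrite mulr_ge0// (le_trans _ (v1 i)).
Qed.

(** Up to a constant, 1 + v.x is at most 1 plus the largest coordinate of x,
    whose power is bounded by the sum of the pure powers of the
    coordinates. *)
Lemma weight_moment_fin (p : nat) (R : realType)
    (mu : probability (p.-tuple nat) R) (v : 'I_p -> R) (n : nat) :
  (0 < p)%N -> (forall j, 1 <= v j) -> finite_moment mu n ->
  (\int[mu]_x ((1 + weight v x) ^+ n)%:E < +oo)%E.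
Proof.
move=> p0 v1 fm; pose D := (2 * (1 + \sum_j v j)) ^+ n.
have v0 j : 0 <= v j by exact: le_trans (v1 j).
have V0 : 0 <= \sum_j v j by apply: sumr_ge0.
have D0 : 0 <= D by rewrite exprn_ge0// mulr_ge0// addr_ge0.
have nat_bound (m : nat) : (1 + m%:R) ^+ n <= 2 ^+ n * (1 + m%:R ^+ n) :> R.
  case: m => [|m].
    rewrite addr0 expr1n; apply: (@le_trans _ _ (2 ^+ n)).
      by rewrite exprn_ege1// ler1n.
    by rewrite ler_peMr ?exprn_ge0// lerDl exprn_ge0.
  apply: (@le_trans _ _ (2 ^+ n * m.+1%:R ^+ n)).
    rewrite -exprMn lerXn2r ?nnegrE ?mulr_ge0 ?addr_ge0//.
    by rewrite mulrDl mul1r lerD2r ler1n.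
  by rewrite ler_wpM2l ?exprn_ge0// lerDr.
have pt x : (1 + weight v x) ^+ n <= D * (1 + \sum_j (tnth x j)%:R ^+ n).
  pose m := \max_j tnth x j.
  have wm : 1 + weight v x <= (1 + \sum_j v j) * (1 + m%:R).
    rewrite mulrDl mul1r lerD ?lerDl// mulrDr mulr1 ler_wpDl//.
    rewrite mulr_suml; apply: ler_sum => j _; rewrite ler_wpM2l// ler_nat.
    exact: leq_bigmax.
  have w0 := weight_ge0 x v1.
  apply: (@le_trans _ _ (((1 + \sum_j v j) * (1 + m%:R)) ^+ n)).
    by rewrite lerXn2r ?nnegrE ?mulr_ge0 ?addr_ge0.
  rewrite exprMn /D exprMn [2 ^+ n * _]mulrC -mulrA ler_wpM2l//.
    by rewrite exprn_ge0// addr_ge0.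
  apply: le_trans (nat_bound m) _; rewrite ler_wpM2l ?exprn_ge0// lerD2l.
  have [j ->] : {j | m = tnth x j} by apply: bigop.eq_bigmax; rewrite card_ord.
  by rewrite (bigD1 j)//= lerDl sumr_ge0// => i _; rewrite exprn_ge0.
have mF (f : p.-tuple nat -> \bar R) : measurable_fun setT f.
  exact: measurable_fun_nat_tuple.
apply: (@le_lt_trans _ _ (\int[mu]_x (D%:E * ((cst 1%E x) +
    \sum_j ((tnth x j)%:R ^+ n)%:E)))%E).
  apply: ge0_le_integral => //.
  - by move=> x _; rewrite lee_fin exprn_ge0// addr_ge0// weight_ge0.
  - by move=> x _; rewrite /cst/= sumEFin -EFinD -EFinM lee_fin.
have t0 x : (0 <= \sum_(j < p) ((tnth x j)%:R ^+ n)%:E :> \bar R)%E.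
  by apply: sume_ge0 => j _; rewrite lee_fin exprn_ge0.
rewrite ge0_integralZl//; last by move=> x _; rewrite adde_ge0.
rewrite ge0_integralD// integral_cst// ge0_integral_sum//.
have /= -> := probability_setT mu.
rewrite mule1 lte_mul_pinfty// lte_add_pinfty ?ltry//.
apply: lte_sum_pinfty => j _.
have := fm (fun i => if i == j then n else 0%N).
rewrite -big_mkcond /= big_pred1_eq => /(_ erefl).
congr (_ < _)%E; apply: eq_integral => x _; congr EFin.
rewrite (bigD1 j)//= eqxx big1 ?mulr1// => i /negPf ->.
by rewrite expr0.
Qed.

Lemma mean_weight (p : nat) (R : realType) d (T : measurableType d)
    (P : probability T R) (Y : {RV P >-> p.-tuple nat}) (v : 'I_p -> R) :
  (forall j, 0 <= v j) -> finite_mean P Y ->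
  (\int[P]_w (weight v (Y w))%:E = (\sum_j v j * mean_vec P Y j ord0)%:E)%E.
Proof.
move=> v0 fY; rewrite /weight.
have mc j : measurable_fun setT (fun w => ((tnth (Y w) j)%:R : R)%:E).
  apply: (@measurableT_comp _ _ _ _ _ _ (fun y : p.-tuple nat =>
    ((tnth y j)%:R : R)%:E)) => //.
  exact: measurable_fun_nat_tuple.
under eq_integral do rewrite -sumEFin.
under eq_integral => w _ do under eq_bigr do rewrite EFinM.
rewrite ge0_integral_sum//; last first.
- by move=> j w _; rewrite mule_ge0// lee_fin.
- by move=> j; apply: emeasurable_funM.
rewrite -sumEFin; apply: eq_bigr => j _; rewrite ge0_integralZl//;
  last by rewrite lee_fin.
rewrite EFinM mxE; congr (_ * _)%E; rewrite fineK unlock//.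
rewrite ge0_fin_numE; first by have := fY j; rewrite unlock.
by apply: integral_ge0 => w _; rewrite lee_fin.
Qed.

Lemma mean_mx_ge0 (p : nat) (R : realType) d (T : measurableType d)
    (P : probability T R) (Y : 'I_p -> T -> p.-tuple nat) (i j : 'I_p) :
  0 <= mean_mx P Y i j.
Proof.
by rewrite !mxE fine_ge0// expectation_ge0.
Qed.

(** * One generation of the branching process *)

Lemma measurable_fun_sumn d (T : measurableType d) (I : Type) (s : seq I)
    (f : I -> T -> nat) :
  (forall i, measurable_fun setT (f i)) ->
  measurable_fun setT (fun w => (\sum_(i <- s) f i w)%N).
Proof.
move=> mf; elim: s => [|i s IH].
  by under eq_fun do rewrite big_nil; exact: measurable_cst.
under eq_fun do rewrite big_cons.
exact: measurable_fun_addn.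
Qed.

Lemma measurable_gwi_step (p : nat) d (T : measurableType d)
    (x : p.-tuple nat) (xi : nat -> 'I_p -> T -> p.-tuple nat)
    (e : T -> p.-tuple nat) :
  (forall l i, measurable_fun setT (xi l i)) -> measurable_fun setT e ->
  measurable_fun setT (fun w => gwi_step x (fun l i => xi l i w) (e w)).
Proof.
move=> mxi me.
have mt (Y : T -> p.-tuple nat) j :
    measurable_fun setT Y -> measurable_fun setT (fun w => tnth (Y w) j).
  by move=> mY; apply: (measurableT_comp (measurable_tnth j)).
apply/measurable_fun_tnthP => j; rewrite /comp /gwi_step.
under eq_fun do rewrite tnth_mktuple.
apply: measurable_fun_addn; last exact: mt.
apply: measurable_fun_sumn => i.
apply: (@measurable_fun_sumn _ _ _ _ (fun (l : 'I_(tnth x i)) w =>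
  tnth (xi l i w) j)) => l.
exact: mt.
Qed.

(** The index 0 refers to the generation that the transition kernel uses. *)
Definition active_inputs (p : nat) (x : p.-tuple nat) :
    seq (unit + (nat * nat * 'I_p) + nat) :=
  inr 0%N ::
  [seq inl (inr (0%N, l, i)) | i <- enum 'I_p, l <- iota 0 (tnth x i)].

Lemma uniq_active_inputs (p : nat) (x : p.-tuple nat) :
  uniq (active_inputs x).
Proof.
rewrite /active_inputs /=; apply/andP; split.
  by apply/negP => /allpairsPdep[? [? []]].
apply: allpairs_uniq_dep => [|i _|[i l] [i' l'] _ _ /= [-> ->]//].
- exact: enum_uniq.
- exact: iota_uniq.
Qed.

Lemma big_active_inputs (S : Type) (idx : S) (op : Monoid.com_law idx)
    (p : nat) (x : p.-tuple nat) (F : unit + (nat * nat * 'I_p) + nat -> S) :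
  \big[op/idx]_(i <- active_inputs x) F i =
  op (F (inr 0%N))
     (\big[op/idx]_(i < p) \big[op/idx]_(l < tnth x i)
        F (inl (inr (0%N, val l, i)))).
Proof.
rewrite /active_inputs big_cons big_allpairs_dep big_enum /=; congr (op _ _).
apply: eq_bigr => i _.
by rewrite -(big_mkord xpredT (fun l => F (inl (inr (0%N, l, i)))))
  /index_iota subn0.
Qed.

Lemma weight_gwi_step (p : nat) (R : realType) d (T : measurableType d)
    (v : 'I_p -> R) (x : p.-tuple nat) (X0 : T -> p.-tuple nat)
    (xi : nat -> nat -> 'I_p -> T -> p.-tuple nat)
    (eps : nat -> T -> p.-tuple nat) (w : T) :
  weight v (gwi_step x (fun l i => xi 0%N l i w) (eps 0%N w)) =
  \sum_(i <- active_inputs x) weight v (gwi_inputs X0 xi eps i w).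
Proof.
rewrite big_active_inputs /= [RHS]addrC /weight /gwi_step.
under [LHS]eq_bigr do rewrite tnth_mktuple natrD mulrDr.
rewrite big_split /=; congr (_ + _).
under [LHS]eq_bigr do rewrite natr_sum mulr_sumr.
rewrite exchange_big; apply: eq_bigr => i _.
under [LHS]eq_bigr do rewrite natr_sum mulr_sumr.
by rewrite exchange_big.
Qed.

(** Below the threshold [t] the term of lower degree is bounded by a constant,
    and above it that term is at most the gap between [l] and [(1 + l) / 2]
    times the leading power. *)
Lemma drift_absorb (R : realFieldType) (l C : R) (n : nat) :
  0 <= l < 1 -> 0 <= C ->
  exists2 b : R, 0 <= b & forall y : R, 1 <= y ->
    l ^+ n.+1 * y ^+ n.+1 + C * y ^+ n <= (1 + l) / 2 * y ^+ n.+1 + b.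
Proof.
move=> /andP[l0 l1] C0; pose t := C / ((1 - l) / 2).
have d0 : 0 < (1 - l) / 2 by rewrite divr_gt0// subr_gt0.
have t0 : 0 <= t by rewrite divr_ge0// ltW.
exists (C * t ^+ n) => [|y y1]; first by rewrite mulr_ge0// exprn_ge0.
have y0 : 0 <= y by exact: le_trans y1.
have H : C * y ^+ n <= (1 - l) / 2 * y ^+ n.+1 + C * t ^+ n.
  have [yt|ty] := leP y t.
    apply: (@le_trans _ _ (C * t ^+ n)).
      by rewrite ler_wpM2l// lerXn2r.
    by rewrite lerDr mulr_ge0// ?exprn_ge0// ltW.
  apply: (@le_trans _ _ ((1 - l) / 2 * y ^+ n.+1)).
    rewrite exprS mulrA ler_wpM2r ?exprn_ge0//.
    by rewrite mulrC -ler_pdivrMr// ltW.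
  by rewrite lerDl mulr_ge0// exprn_ge0.
have L : l ^+ n.+1 * y ^+ n.+1 <= l * y ^+ n.+1.
  by rewrite ler_wpM2r ?exprn_ge0// exprS ler_piMr// exprn_ile1// ltW.
apply: le_trans (lerD L H) _; rewrite addrA lerD2r -mulrDl.
by rewrite (_ : l + (1 - l) / 2 = (1 + l) / 2)//; field.
Qed.

(** The hypothesis on [v] says v M = v - 1, and v - 1 <= l v for
    l = 1 - 1 / (v_1 + ... + v_p); hence the mean weight of the offspring of x
    is at most l v.x.  Every other quantity in the moment recursion is bounded
    by a constant times the number of summands, hence by a constant
    times 1 + v.x. *)
Lemma gwi_weight_drift (p : nat) (R : realType) d (T : measurableType d)
    (P : probability T R)
    (X : nat -> {RV P >-> p.-tuple nat})
    (xi : nat -> nat -> 'I_p -> {RV P >-> p.-tuple nat})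
    (eps : nat -> {RV P >-> p.-tuple nat})
    (xi_gen : 'I_p -> {RV P >-> p.-tuple nat})
    (eps_gen : {RV P >-> p.-tuple nat}) (v : 'I_p -> R) (n : nat) :
  (0 < p)%N -> is_gwi X xi eps xi_gen eps_gen ->
  (forall i, finite_mean P (xi_gen i)) -> finite_mean P eps_gen ->
  (forall j, 1 <= v j) ->
  (forall j, \sum_i v i * mean_mx P xi_gen i j = v j - 1) ->
  (forall i, finite_moment (distribution P (xi_gen i)) n.+1) ->
  finite_moment (distribution P eps_gen) n.+1 ->
  exists r B : R, [/\ 0 <= r < 1, 0 <= B & forall x,
    (\int[P]_w ((1 + weight v
        (gwi_step x (fun l i => xi 0%N l i w) (eps 0%N w))) ^+ n.+1)%:E <=
     (r * (1 + weight v x) ^+ n.+1 + B)%:E)%E].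
Proof.
move=> p0 [_ iY xi_law eps_law] fxi feps v1 vM mxi meps.
have v0 j : 0 <= v j by exact: le_trans (v1 j).
set Y := gwi_inputs _ _ _ in iY.
have mY i : measurable_fun setT (Y i).
  by case: i => [[[]|[[k l] i]]|k]; exact: measurable_funPT.
pose h := weight v.
have h0 y : 0 <= h y by exact: weight_ge0.
(* Each input has the law of its generic vector, so only [x] matters. *)
have sumY x (f : p.-tuple nat -> R) : (forall y, 0 <= f y) ->
    (\sum_(i <- active_inputs x) \int[P]_w (f (Y i w))%:E =
     \int[P]_w (f (eps_gen w))%:E +
     \sum_i \sum_(l < tnth x i) \int[P]_w (f (xi_gen i w))%:E)%E.
  move=> f0; rewrite big_active_inputs /=; congr (_ + _)%E.
    by apply: (@eq_law_integral _ _ _ _ P _ _ (EFin \o f)).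
  apply: eq_bigr => i _; apply: eq_bigr => l _.
  by apply: (@eq_law_integral _ _ _ _ P _ _ (EFin \o f)).
have hn_fin (Z : {RV P >-> p.-tuple nat}) :
    finite_moment (distribution P Z) n.+1 ->
    (\int[P]_w ((1 + h (Z w)) ^+ n.+1)%:E)%E \is a fin_num.
  move=> mZ; rewrite ge0_fin_numE; last first.
    by apply: integral_ge0 => w _; rewrite lee_fin exprn_ge0// addr_ge0.
  have := weight_moment_fin p0 v1 mZ; rewrite ge0_integral_distribution//.
  - exact: measurable_fun_nat_tuple.
  - by move=> y; rewrite lee_fin exprn_ge0// addr_ge0// weight_ge0.
pose J (Z : {RV P >-> p.-tuple nat}) :=
  fine (\int[P]_w ((1 + h (Z w)) ^+ n.+1)%:E)%E.
have J0 Z : 0 <= J Z.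
  apply: fine_ge0; apply: integral_ge0 => w _.
  by rewrite lee_fin exprn_ge0// addr_ge0.
pose m := \sum_j v j * mean_vec P eps_gen j ord0.
have m0 : 0 <= m.
  apply: sumr_ge0 => j _; rewrite mulr_ge0// mxE fine_ge0// expectation_ge0//.
have V1 : 1 <= \sum_j v j.
  rewrite (bigD1 (Ordinal p0))//= -[leLHS]addr0 lerD//.
  exact: sumr_ge0.
(* The rate at which [v] is contracted: v_j <= v_1 + ... + v_p. *)
pose l := 1 - (\sum_j v j)^-1.
have l01 : 0 <= l < 1.
  rewrite /l subr_ge0 invf_le1 ?(lt_le_trans _ V1)// V1/=.
  by rewrite ltrBlDr ltrDl invr_gt0 (lt_le_trans _ V1).
have vl j : v j - 1 <= l * v j.
  rewrite /l mulrBl mul1r lerD2l lerN2 mulrC ler_pdivrMr ?(lt_le_trans _ V1)//.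
  by rewrite mul1r (bigD1 j)//= lerDl sumr_ge0.
have mean_bound x : (1 + \sum_(i <- active_inputs x) \int[P]_w (h (Y i w))%:E <=
    (l * (1 + h x) + (1 + m))%:E)%E.
  rewrite sumY// mean_weight// -/m.
  rewrite (eq_bigr (fun i => ((v i - 1) * (tnth x i)%:R)%:E)); last first.
    move=> i _; rewrite mean_weight// (_ : \sum_j _ = v i - 1).
      by rewrite sumEFin sumr_const card_ord mulr_natr.
    by rewrite -vM; apply: eq_bigr => j _; rewrite [mean_mx _ _ _ _]mxE.
  rewrite sumEFin -!EFinD lee_fin addrA [leRHS]addrC lerD2l.
  apply: (@le_trans _ _ (l * h x)); last first.
    by rewrite mulrDr lerDr mulr1; case/andP: l01.
  rewrite mulr_sumr; apply: ler_sum => i _.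
  by rewrite mulrA ler_wpM2r// vl.
pose c := J eps_gen + \sum_i J (xi_gen i).
have c0 : 0 <= c by rewrite addr_ge0// sumr_ge0.
have excess_bound x k : (k.+2 <= n.+1)%N ->
    (\sum_(i <- active_inputs x)
       \int[P]_w (h (Y i w) * (1 + h (Y i w)) ^+ k.+1)%:E <=
     (c * (1 + h x))%:E)%E.
  move=> kn; rewrite (sumY x (fun y => h y * (1 + h y) ^+ k.+1)); last first.
    by move=> y; rewrite mulr_ge0// exprn_ge0// addr_ge0.
  have le_J (Z : {RV P >-> p.-tuple nat}) :
      finite_moment (distribution P Z) n.+1 ->
      (\int[P]_w (h (Z w) * (1 + h (Z w)) ^+ k.+1)%:E <= (J Z)%:E)%E.
    move=> mZ; rewrite /J fineK ?hn_fin//.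
    have mf (f : p.-tuple nat -> \bar R) :
        measurable_fun setT (fun w => f (Z w)).
      by apply: measurableT_comp => //; exact: measurable_fun_nat_tuple.
    apply: ge0_le_integral => //.
    - by move=> w _; rewrite lee_fin mulr_ge0// exprn_ge0// addr_ge0.
    - exact: (mf (fun y => (h y * (1 + h y) ^+ k.+1)%:E)).
    - exact: (mf (fun y => ((1 + h y) ^+ n.+1)%:E)).
    move=> w _; rewrite lee_fin.
    apply: (@le_trans _ _ ((1 + h (Z w)) ^+ k.+2)).
      by rewrite [leRHS]exprS ler_wpM2r ?exprn_ge0 ?addr_ge0// lerDr.
    by rewrite ler_weXn2l// lerDl.
  apply: (@le_trans _ _ ((J eps_gen)%:E +
      \sum_i (J (xi_gen i) * (tnth x i)%:R)%:E)%E).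
    apply: leeD; first exact: le_J.
    apply: lee_sum => i _.
    rewrite (_ : J (xi_gen i) * _ = \sum_(k' < tnth x i) J (xi_gen i)).
      by rewrite -sumEFin; apply: lee_sum => k' _; exact: le_J.
    by rewrite sumr_const card_ord mulr_natr.
  rewrite sumEFin -EFinD lee_fin /c mulrDl lerD//.
    by rewrite ler_peMr// lerDl.
  rewrite mulr_suml; apply: ler_sum => i _; rewrite ler_wpM2l//.
  by apply: le_trans (tnth_le_weight x i v1) _; rewrite lerDr.
have b0 : 0 <= 1 + m by exact: addr_ge0.
have l01' : 0 <= l <= 1 by case/andP: l01 => -> /ltW ->.
have [C C0 HC] := two_term_moment_bound n.+1 l01' b0 c0.
have [B B0 HB] := drift_absorb n l01 C0.
have S1 x w : 1 <= shifted_sum Y h (active_inputs x) w.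
  by rewrite lerDl; apply: sumr_ge0.
exists ((1 + l) / 2), B; split=> // [|x].
  by case/andP: l01 => l0 l1; apply/andP; split; lra.
pose u k := (\int[P]_w (shifted_sum Y h (active_inputs x) w ^+ k)%:E)%E.
rewrite (_ : (\int[P]_w _)%E = u n.+1); last first.
  apply: eq_integral => w _; congr ((_ ^+ _)%:E); congr (1 + _).
  exact: (weight_gwi_step v x (X 0%N) (fun k l i => xi k l i)).
have u0 k : (0 <= u k)%E.
  apply: integral_ge0 => w _; rewrite lee_fin exprn_ge0//.
  exact: le_trans (S1 x w).
have y1 : 1 <= 1 + h x by rewrite lerDl.
apply: le_trans (HC u _ y1 _ _ _) _.
- rewrite /u (eq_integral (cst 1%E)) => [|w _]; last by rewrite expr0.
  by rewrite integral_cst//; have /= -> := probability_setT P; rewrite mule1.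
- apply: le_trans (mean_bound x); rewrite /u.
  have E w : ((shifted_sum Y h (active_inputs x) w ^+ 1)%:E = cst 1%E w +
      \sum_(i <- active_inputs x) (h (Y i w))%:E)%E.
    by rewrite expr1 sumEFin -EFinD.
  have mh i : measurable_fun setT (fun w => (h (Y i w))%:E).
    apply: (@measurableT_comp _ _ _ _ _ _ (fun y => (h y)%:E)) => //.
    exact: measurable_fun_nat_tuple.
  under eq_integral do rewrite E.
  rewrite ge0_integralD//; first last.
  + exact: emeasurable_sum.
  + by move=> w _; apply: sume_ge0 => i _; rewrite lee_fin.
  rewrite integral_cst//; have /= -> := probability_setT P; rewrite mule1.
  rewrite ge0_integral_sum// => i w _; by rewrite lee_fin.
- move=> k kn; apply: le_trans (shifted_sum_moment_rec k mY iY h0 _) _.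
    exact: uniq_active_inputs.
  apply: leeD; apply: lee_wpmul2r.
  + exact: (u0 k.+1).
  + exact: mean_bound.
  + exact: (u0 k).
  + exact: excess_bound.
- by rewrite lee_fin HB.
Qed.

Theorem lemma2p3 (p : nat) (hp : (0 < p)%N) (R : realType)
    (d : measure_display) (T : measurableType d) (P : probability T R)
    (X : nat -> {RV P >-> p.-tuple nat})
    (xi : nat -> nat -> 'I_p -> {RV P >-> p.-tuple nat})
    (eps : nat -> {RV P >-> p.-tuple nat})
    (xi_gen : 'I_p -> {RV P >-> p.-tuple nat})
    (eps_gen : {RV P >-> p.-tuple nat})
    (hX : is_gwi X xi eps xi_gen eps_gen)
    (hxi : forall i, finite_mean P (xi_gen i))
    (heps : finite_mean P eps_gen)
    (heps0 : mean_vec P eps_gen != 0)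
    (hrho : spectral_radius (mean_mx P xi_gen) < 1)
    (hprim : primitive_mx (mean_mx P xi_gen))
    (pi : probability (p.-tuple nat) R)
    (hpi : stationary (gwi_kernel xi eps) pi)
    (alpha : nat) (halpha : alpha \in [:: 1; 2; 3]%N)
    (hxia : forall i, finite_moment (distribution P (xi_gen i)) alpha)
    (hepsa : finite_moment (distribution P eps_gen) alpha) :
  finite_moment pi alpha.
Proof.
have [n nE] : exists n, alpha = n.+1.
  by move: halpha; case: (alpha) => // n _; exists n.
rewrite {}nE in hxia hepsa *.
have [v [v1 vM]] := subinvariant_weight (mean_mx_ge0 P xi_gen) hrho.
have [r [B [r01 B0 drift]]] :=
  gwi_weight_drift hp hX hxi heps v1 vM hxia hepsa.
pose V y := (1 + weight v y) ^+ n.+1.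
have w0 y : 0 <= weight v y by exact: weight_ge0.
have V0 y : 0 <= V y by rewrite exprn_ge0// addr_ge0.
pose f x w := gwi_step x (fun l i => xi 0%N l i w) (eps 0%N w).
have mf x : measurable_fun setT (f x).
  apply: (@measurable_gwi_step _ _ _ x (fun l i => xi 0%N l i)).
    by move=> ? ?; exact: measurable_funPT.
  exact: measurable_funPT.
have := stationary_drift_bound mf hpi V0 r01 B0 drift.
move=> /le_lt_trans/(_ (ltry _)) fin a an.
apply: le_lt_trans fin; apply: ge0_le_integral => //.
- by move=> x _; rewrite lee_fin prodr_ge0// => j _; rewrite exprn_ge0.
- exact: measurable_fun_nat_tuple.
- exact: measurable_fun_nat_tuple.
move=> x _; rewrite lee_fin /V -an.
rewrite expr_sum; apply: ler_prod => j _; rewrite exprn_ge0//=.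
rewrite lerXn2r ?nnegrE ?addr_ge0//.
by apply: le_trans (tnth_le_weight x j v1) _; rewrite lerDr.
Qed.
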